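(* Let $a,b$ be complex numbers, let $f_3(z,a,b)=\sum_{n\ge0}c(n,3,a,b)z^n$ be the unique formal power series with $f_3=1+azf_3+bz^3f_3^2$, and $d_2^{(3)}(N,a,b)=\det\big(c(i+j+2,3,a,b)\big)_{i,j=0}^{N-1}$. Then for all $n\ge0$ $$d_2^{(3)}(3n,a,b)=(-1)^{n+1}b^{3n^2+n-1}\Big(a^3\sum_{i=0}^ni^2-(n+1)b\Big),$$ $$d_2^{(3)}(3n+1,a,b)=(-1)^n(n+1)^2a^2b^{3n^2+3n},$$ $$d_2^{(3)}(3n+2,a,b)=(-1)^nb^{3n^2+5n+1}\Big(a^3\sum_{i=0}^{n+1}i^2-(n+1)b\Big).$$
   Context: The determinant of a $0\times0$ matrix is $1$ (for $n=0$ the first formula is to be read as $(-1)\,b^{-1}(-b)=1$). *)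

(* Defs.v *)
From mathcomp Require Import all_boot all_order all_algebra.

Set Implicit Arguments.
Unset Strict Implicit.
Unset Printing Implicit Defensive.

Import GRing.Theory.
Local Open Scope ring_scope.

(* A formal power series is identified with its coefficient sequence; equality
   of series is pointwise equality (=1). *)
Definition fps (K : comNzRingType) := nat -> K.

Section FormalPowerSeries.
Variable K : comNzRingType.
Implicit Types f g : fps K.

Definition fpsX k : fps K := fun n => (n == k)%:R.

Definition fps_add f g : fps K := fun n => f n + g n.

Definition fps_scale (x : K) f : fps K := fun n => x * f n.

Definition fps_mul f g : fps K := fun n => \sum_(i < n.+1) f i * g (n - i)%N.

(* f = 1 + a z f + b z^3 f^2 *)
Definition f3_equation (a b : K) f : Prop :=
  f =1 fps_add (fpsX 0)
         (fps_add (fps_scale a (fps_mul (fpsX 1) f))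
                  (fps_scale b (fps_mul (fpsX 3) (fps_mul f f)))).

Definition shifted_hankel_det (m : nat) f (N : nat) : K :=
  \det (\matrix_(i < N, j < N) f (i + j + m)%N).

Lemma fps_mulXE k f n : fps_mul (fpsX k) f n = if (k <= n)%N then f (n - k)%N else 0.
Proof.
rewrite /fps_mul /fpsX; case: leqP => [le_kn | lt_nk].
  have lt_kn : (k < n.+1)%N by [].
  rewrite (bigD1 (Ordinal lt_kn)) //= eqxx mul1r big1 ?addr0 // => i.
  by rewrite -val_eqE /= => /negPf ->; rewrite mul0r.
rewrite big1 // => i _.
by rewrite ltn_eqF ?mul0r // (leq_trans (ltn_ord i)).
Qed.

Let step (a b : K) f n : K :=
  (n == 0%N)%:R + ((if (1 <= n)%N then a * f n.-1 else 0)
    + (if (3 <= n)%N then b * \sum_(i < (n - 3).+1) f i * f (n - 3 - i)%N else 0)).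

Let stepP a b f : f3_equation a b f <-> f =1 step a b f.
Proof.
have e n : fps_add (fpsX 0)
   (fps_add (fps_scale a (fps_mul (fpsX 1) f))
            (fps_scale b (fps_mul (fpsX 3) (fps_mul f f)))) n = step a b f n.
  rewrite /fps_add /fps_scale !fps_mulXE /step /fpsX subn1.
  by case: (1 <= n)%N; case: (3 <= n)%N; rewrite ?mulr0.
by split=> h n; rewrite h e.
Qed.

Let step_ext a b f g n :
  (forall m, (m < n)%N -> f m = g m) -> step a b f n = step a b g n.
Proof.
move=> h; rewrite /step; congr (_ + (_ + _)).
  by case: n h => //= n h; rewrite h.
case: leqP => // n3; congr (_ * _); apply: eq_bigr => i _.
have lt_n : (n - 3 < n)%N by rewrite ltn_subrL (leq_trans _ n3).
have hi : (i <= n - 3)%N by rewrite -ltnS.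
by rewrite !h // ?(leq_ltn_trans hi) // (leq_ltn_trans (leq_subr _ _)).
Qed.

Lemma f3_existence (a b : K) : exists f, f3_equation a b f.
Proof.
pose F := fix F k : fps K := if k is k'.+1 then step a b (F k') else fun=> 0.
have F_stable n : forall k, (n < k)%N -> F k n = F n.+1 n.
  elim/ltn_ind: n => n IHn [//|k]; rewrite ltnS => le_nk /=.
  apply: step_ext => m lt_mn.
  by rewrite IHn ?(leq_trans lt_mn) // [RHS]IHn.
exists (fun n => F n.+1 n); apply/stepP => n.
by apply: step_ext => m lt_mn; apply: F_stable.
Qed.

Lemma f3_uniqueness (a b : K) f g :
  f3_equation a b f -> f3_equation a b g -> f =1 g.
Proof.
move=> /stepP hf /stepP hg n.
elim/ltn_ind: n => n IHn; rewrite hf hg.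
exact: step_ext.
Qed.

End FormalPowerSeries.

(* Main.v *)
Require Import Defs.
From mathcomp Require Import all_boot all_order all_algebra.
From mathcomp Require Import reals complex.
From mathcomp Require Import ring zify.

Set Implicit Arguments.
Unset Strict Implicit.
Unset Printing Implicit Defensive.

Import Order.TTheory GRing.Theory Num.Theory.
Local Open Scope ring_scope.

(** [d_2(N)] is the (0,0)-cofactor of the unshifted Hankel matrix [H] of size
    [N+1].  The equation [1/f = 1 - az - bz^3 f] unfolds into a continued
    fraction whose convergents have denominators [Q_j] with
    [Q_(j+1) = (1 - az) Q_j - bz^3 Q_(j-1)] and
    [Q_j f = Q_(j-1) + b^j z^(3j) f^(j+1)].  Hence the reversed coefficients of
    the [Q_j] give combinations of the rows of [H] that vanish in all columns
    but the last: this evaluates [det H] in sizes [3n+1] and [3n+3], and yields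
    a kernel vector in size [3n+2], where the cofactor is [det] in size [3n+1]
    times the square of a top coefficient of [Q_(2n+1)].  In the other two
    sizes, a combination of two consecutive [Q_j] yields a multiple of the first
    basis vector, so that the cofactor is [det H] times an expression in the two
    top coefficients of the [Q_j].  The multiple is a power of [-b], whence the
    separate treatment of [b = 0]. *)

(** * Cofactors from linear relations between rows *)

Section Cofactors.
Variable K : comNzRingType.

(** Multiply on the right by the adjugate and compare entries [i]. *)
Lemma cofactor_of_row_combination n (A : 'M[K]_n) (v : 'rV[K]_n) h i j :
  v *m A = h *: delta_mx 0 j -> v 0 i * \det A = h * cofactor A i j.
Proof.
move=> vA.
have := congr1 (fun B : 'rV_n => (B *m \adj A) 0 i) vA.
rewrite -mulmxA mul_mx_adj mul_mx_scalar -scalemxAl -rowE !mxE.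
by rewrite mulrC.
Qed.

(* Apply the previous lemma to [A] with its column [j] replaced by the [i]-th
   basis vector. *)
Lemma cofactor_of_left_kernel n (A : 'M[K]_n) (v : 'rV[K]_n) i j k :
  v *m A = 0 -> v 0 k * cofactor A i j = v 0 i * cofactor A k j.
Proof.
move=> vA.
pose B : 'M[K]_n := \matrix_(s, t) if t == j then (s == i)%:R else A s t.
have cofB s : cofactor B s j = cofactor A s j.
  rewrite /cofactor; congr (_ * \det _); apply/matrixP=> x y.
  by rewrite !mxE eq_sym (negPf (neq_lift _ _)).
have detB : \det B = cofactor A i j.
  rewrite (expand_det_col _ j) (bigD1 i) //= big1 => [|s si].
    by rewrite mxE !eqxx mul1r addr0 cofB.
  by rewrite mxE eqxx (negPf si) mul0r.
rewrite -detB -cofB; apply: cofactor_of_row_combination.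
apply/rowP=> t; rewrite !mxE eqxx /=.
have [-> | tj] := eqVneq t j.
  rewrite mulr1 (bigD1 i) //= big1 => [|s si].
    by rewrite mxE !eqxx mulr1 addr0.
  by rewrite mxE eqxx (negPf si) mulr0.
have /rowP/(_ t) := vA; rewrite !mxE mulr0; apply: etrans.
by apply: eq_bigr => s _; rewrite mxE (negPf tj).
Qed.

End Cofactors.

Lemma bump_small h k : (k < h)%N -> bump h k = k.
Proof. by rewrite /bump ltnNge => /negPf ->. Qed.

(** * Reversed polynomials acting on Hankel matrices *)

Section Hankel.
Variable K : comNzRingType.
Implicit Types (c : fps K) (W : {poly K}).

Definition hankel c N : 'M[K]_N := \matrix_(i, j) c (i + j)%N.

(* The coefficients of [W], read as a polynomial of degree [N], in reverse. *)
Definition rev_coefs N W : 'rV[K]_N.+1 := \row_k W`_(N - k).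

(** Reversal turns the Hankel sum into a Cauchy product. Since [N + i < M], truncating the series
    loses no term. *)
Lemma rev_coefs_convolution N M c W i : (size W <= N.+1)%N -> (N + i < M)%N ->
  \sum_(k < N.+1) rev_coefs N W 0 k * c (k + i)%N
    = (W * \poly_(l < M) c l)`_(N + i).
Proof.
move=> szW ltM; rewrite coefM.
rewrite -(big_mkord xpredT
  (fun l => W`_l * (\poly_(l0 < M) c l0)`_(N + i - l))) /=.
rewrite (@big_cat_nat _ _ _ N.+1) //=; last by rewrite ltnS leq_addr.
rewrite [X in _ = _ + X]big1_seq => [|l]; last first.
  by rewrite mem_index_iota => /andP[_ /andP[Nl _]]; rewrite nth_default ?mul0r // (leq_trans szW).
rewrite addr0 big_mkord (reindex_inj rev_ord_inj) /=; apply: eq_bigr => k _.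
have ltk := ltn_ord k.
rewrite mxE coef_poly /= !subSS (_ : (N - (N - k) = k)%N); last by lia.
by rewrite ifT; [congr (_ * c _); lia | lia].
Qed.

Lemma rev_coefs_hankel N M c W : (size W <= N.+1)%N -> (N.*2 < M)%N ->
  rev_coefs N W *m hankel c N.+1
    = \row_i (W * \poly_(l < M) c l)`_(N + i).
Proof.
move=> szW ltM; apply/rowP=> i; rewrite !mxE.
rewrite -rev_coefs_convolution //; last by have := ltn_ord i; lia.
by apply: eq_bigr => k _; rewrite !mxE.
Qed.

Lemma cofactor_hankel_first c N :
  cofactor (hankel c N.+1) 0 0 = shifted_hankel_det 2 c N.
Proof.
rewrite /cofactor expr0 mul1r; congr (\det _); apply/matrixP=> i j.
by rewrite !mxE /= /bump /=; congr c; lia.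
Qed.

Lemma cofactor_hankel_last c N :
  cofactor (hankel c N.+1) ord_max ord_max = \det (hankel c N).
Proof.
rewrite /cofactor -signr_odd oddD addbb expr0 mul1r; congr (\det _).
by apply/matrixP=> i j; rewrite !mxE /= !bump_small // ltn_ord.
Qed.

Lemma tr_hankel c N : (hankel c N)^T = hankel c N.
Proof. by apply/matrixP=> i j; rewrite !mxE addnC. Qed.

Lemma det_hankel_rec c N W h : W`_0 = 1 ->
    rev_coefs N W *m hankel c N.+1 = h *: delta_mx 0 ord_max ->
  \det (hankel c N.+1) = h * \det (hankel c N).
Proof.
move=> W0 /(cofactor_of_row_combination ord_max).
by rewrite mxE subnn W0 mul1r cofactor_hankel_last.
Qed.

Lemma shifted_hankel_det_scaled c N W h :
    rev_coefs N W *m hankel c N.+1 = h *: delta_mx 0 0 ->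
  W`_N * \det (hankel c N.+1) = h * shifted_hankel_det 2 c N.
Proof.
move=> /(cofactor_of_row_combination 0).
by rewrite mxE subn0 cofactor_hankel_first.
Qed.

Lemma shifted_hankel_det_singular c N W : W`_0 = 1 ->
    rev_coefs N W *m hankel c N.+1 = 0 ->
  shifted_hankel_det 2 c N = W`_N ^+ 2 * \det (hankel c N).
Proof.
move=> W0 WH.
have kerE i j : cofactor (hankel c N.+1) i j
    = rev_coefs N W 0 i * cofactor (hankel c N.+1) ord_max j.
  rewrite -(cofactor_of_left_kernel _ _ _ WH).
  by rewrite mxE subnn W0 mul1r.
rewrite -cofactor_hankel_first kerE -[hankel _ _]tr_hankel cofactor_tr kerE.
by rewrite cofactor_hankel_last mxE subn0 mulrA expr2.
Qed.

(* The minor obtained by deleting the last row and the last but one column is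
   reduced to [hankel c N] by the same linear combination of its rows. *)
Lemma det_hankel_rec2 c N W h : W`_0 = 1 ->
    rev_coefs N.+1 ('X * W) *m hankel c N.+2 = h *: delta_mx 0 ord_max ->
  \det (hankel c N.+2) = - h ^+ 2 * \det (hankel c N).
Proof.
move=> W0 WH.
have [i0 val_i0] : exists i0 : 'I_N.+2, i0 = N :> nat.
  by exists (inord N); rewrite inordK.
have := cofactor_of_row_combination i0 WH.
rewrite mxE val_i0 coefXM subSnn /= W0 mul1r => ->.
rewrite /cofactor val_i0 /= addnS exprS -signr_odd oddD addbb expr0 mulr1.
set A := row' _ _; rewrite -det_tr.
have := @cofactor_of_row_combination _ _ A^T (rev_coefs N W) h ord_max ord_max.
rewrite mxE subnn W0 mul1r => ->; last first.
  apply/rowP=> j; have /rowP/(_ (lift i0 j)) := WH; rewrite !mxE eqxx /=.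
  (* The constant coefficient of ['X * W] is 0, so the last row, deleted in the minor, does not
     enter the combination. *)
  rewrite big_ord_recr /= mxE coefXM subnn mul0r addr0.
  have -> : (lift i0 j == ord_max) = (j == ord_max).
    rewrite -!val_eqE /= val_i0 /bump; have := ltn_ord j.
    by case: leqP; lia.
  move=> <-; apply: eq_bigr => k _; have ltk := ltn_ord k.
  rewrite !mxE coefXM /= subn_eq0 leqNgt ltk subSn //=.
  by rewrite (bump_small ltk) addnC.
suff -> : cofactor A^T ord_max ord_max = \det (hankel c N) by ring.
rewrite /cofactor -signr_odd oddD addbb expr0 mul1r; congr (\det _).
apply/matrixP=> i j; have ltj := ltn_ord j; have lti := ltn_ord i.
rewrite !mxE /= !(bump_small lti) !(bump_small ltj).
by rewrite !bump_small 1?addnC //; lia.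
Qed.

End Hankel.

(** * Degrees and top coefficients of the convergent denominators *)

Section Denominators.
Variables (K : comNzRingType) (a b : K).

(* [denom j.+1] is the denominator of the [j]-th convergent of
   1/(1 - az - bz^3/(1 - az - bz^3/...)), and [denom j] is its numerator. *)
Fixpoint denom j : {poly K} :=
  match j with
  | 0 => 0
  | 1 => 1
  | (k.+1 as k').+1 => (1 - a%:P * 'X) * denom k' - b%:P * 'X^3 * denom k
  end.

Lemma denomSS j :
  denom j.+2 = (1 - a%:P * 'X) * denom j.+1 - b%:P * 'X^3 * denom j.
Proof. by []. Qed.

Lemma coef_denomSS j n : (denom j.+2)`_n.+3
  = (denom j.+1)`_n.+3 - a * (denom j.+1)`_n.+2 - b * (denom j)`_n.
Proof.
by rewrite denomSS coefB mulrBl mul1r coefB -!mulrA !coefCM !coefXM /=.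
Qed.

Lemma coef0_denom j : (denom j.+1)`_0 = 1.
Proof.
elim: j => [|j IH]; first by rewrite coef1.
by rewrite denomSS coefB mulrBl mul1r coefB -!mulrA !coefCM !coefXM /=
  !mulr0 !subr0.
Qed.

Lemma size_denom n :
  (size (denom n.*2.+1) <= (3 * n).+1)%N /\
  (size (denom n.*2.+2) <= (3 * n).+2)%N.
Proof.
have key j k l m : (k < m)%N -> (l + 2 < m)%N ->
    (size (denom j.+1) <= k)%N -> (size (denom j) <= l)%N -> (size (denom j.+2) <= m)%N.
  move=> km lm /leq_sizeP sk /leq_sizeP sl; apply/leq_sizeP => i mi.
  have [i' def_i] : exists i', i = i'.+3 by exists (i - 3)%N; lia.
  rewrite {}def_i in mi *.
  by rewrite coef_denomSS !sk ?sl ?mulr0 ?subr0 //; lia.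
elim: n => [|n [IH1 IH2]].
  split; first by rewrite size_poly1.
  apply/leq_sizeP => -[|[|i]] // _.
  rewrite denomSS coefB mulrBl mul1r coefB -!mulrA !coefCM !coefXM /=.
  by rewrite !coef1 coef0 /= !(if_same, mulr0, subr0).
have IH3 : (size (denom n.+1.*2.+1) <= (3 * n.+1).+1)%N.
  by rewrite doubleS; apply: key IH2 IH1; lia.
split=> //; rewrite doubleS in IH3 *.
by apply: key IH3 IH2; lia.
Qed.

Lemma coef_denom_odd n i : (3 * n < i)%N -> (denom n.*2.+1)`_i = 0.
Proof. by move=> ?; rewrite nth_default // (leq_trans (size_denom n).1). Qed.

Lemma coef_denom_even n i : (3 * n <= i.+1)%N -> (denom n.*2)`_i = 0.
Proof.
case: n => [|n] le_ni; first by rewrite coef0.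
by rewrite doubleS nth_default // (leq_trans (size_denom n).2) //; lia.
Qed.

(** Leading and subleading coefficients, by the recurrence and Pascal's rule. The last one carries
    [(-b)^(n-1)]; the factor [- b] keeps the exponent natural at [n = 0]. *)
Lemma denom_coefs n :
  [/\ (denom n.*2.+1)`_(3 * n) = (- b) ^+ n,
      (denom n.*2.+2)`_(3 * n).+1 = - n.+1%:R * a * (- b) ^+ n,
      (denom n.*2.+3)`_(3 * n).+2 = a ^+ 2 * 'C(n.+2, 2)%:R * (- b) ^+ n
    & - b * (denom n.*2.+2)`_(3 * n)
       = (- b) ^+ n * (n.+1%:R * - b - a ^+ 3 * 'C(n.+2, 3)%:R)].
Proof.
have low j : (denom j.+2)`_2 = (denom j.+1)`_2 - a * (denom j.+1)`_1.
  by rewrite denomSS coefB mulrBl mul1r coefB -!mulrA !coefCM !coefXM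
    /= mulr0 subr0.
have low1 : (denom 2)`_1 = - a.
  by rewrite denomSS coefB mulrBl mul1r coefB -!mulrA !coefCM !coefXM
    /= !coef1 /= mulr0 subr0 mulr1 sub0r.
have top := coef_denom_odd.
have top' m i : ((3 * m).+1 < i)%N -> (denom m.*2.+2)`_i = 0.
  by move=> lt_mi; rewrite -doubleS coef_denom_even //; lia.
elim: n => [|n [IH1 IH2 IH3 IH4]].
  rewrite muln0 double0 !coef0_denom !expr0; split=> //.
  - by rewrite low1; ring.
  - rewrite low (top' 0%N) // low1 (_ : 'C(2, 2) = 1%N) //; ring.
  - rewrite (_ : 'C(2, 3) = 0%N) //; ring.
have e3 : (3 * n.+1 = (3 * n).+3)%N by lia.
have E1 : (denom n.+1.*2.+1)`_(3 * n.+1) = (- b) ^+ n.+1.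
  rewrite doubleS e3 coef_denomSS !top' ?IH1; try lia.
  by rewrite exprS; ring.
have E2 : (denom n.+1.*2.+2)`_(3 * n.+1).+1 = - n.+2%:R * a * (- b) ^+ n.+1.
  rewrite e3 coef_denomSS top; last by lia.
  by rewrite -e3 E1 doubleS IH2 exprS -(natr1 n.+1); ring.
have bin2 : 'C(n.+3, 2)%:R = 'C(n.+2, 2)%:R + n.+2%:R :> K.
  by rewrite binS bin1 natrD.
have bin3 : 'C(n.+3, 3)%:R = 'C(n.+2, 3)%:R + 'C(n.+2, 2)%:R :> K.
  by rewrite binS natrD.
split=> //.
- rewrite e3 coef_denomSS top'; last by lia.
  rewrite -e3 E2 doubleS IH3 bin2 exprS; ring.
- rewrite e3 coef_denomSS -e3 E1 doubleS IH3 bin3.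
  rewrite mulrBr [- b * (b * _)]mulrCA IH4 exprS -(natr1 n.+1); ring.
Qed.

End Denominators.

Arguments denom {K} a b j : simpl never.

(** * Approximation of the series and evaluation of Hankel determinants *)

Section Expansion.
Variables (K : comNzRingType) (a b : K) (c : fps K).
Hypothesis hc : f3_equation a b c.

Let p M : {poly K} := \poly_(i < M) c i.

Lemma f3_truncation M : exists r,
  p M = 1 + a%:P * 'X * p M + b%:P * 'X^3 * p M ^+ 2 + 'X^M * r.
Proof.
set q := 1 + _ + _; exists (drop_poly M (p M - q)).
have := poly_take_drop M (p M - q).
suff -> : take_poly M (p M - q) = 0.
  by rewrite add0r ['X^M * _]mulrC => ->; rewrite addrC subrK.
apply/polyP=> i; rewrite coef_take_poly coef0; case: ltnP => // iM.
apply/eqP; rewrite coefB subr_eq0 /q !coefD -!mulrA !coefCM !coefXM.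
rewrite coef1 coef_poly iM hc /fps_add /fps_scale !fps_mulXE /fpsX -addrA.
apply/eqP; congr (_ + (_ * _ + _ * _)).
  by case: i iM => //= i iM; rewrite subn1 coef_poly ltnW.
case: i iM => [|[|[|i]]] //= iM; rewrite !subSS subn0 expr2 coefM.
apply: eq_bigr => l _.
by rewrite !coef_poly !ifT //; have := ltn_ord l; lia.
Qed.

(** The error terms obey the recurrence of the denominators, because [(1 - az) f - 1 = b z^3 f^2].
    The recurrence has order two, so two consecutive indices are carried through the induction. *)
Lemma denom_mul_truncation M j : exists r, denom a b j.+1 * p M
  = denom a b j + (b ^+ j)%:P * 'X^(3 * j) * p M ^+ j.+1 + 'X^M * r.
Proof.
have [r0 r0E] := f3_truncation M.
suff [] : (exists r, denom a b j.+1 * p M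
    = denom a b j + (b ^+ j)%:P * 'X^(3 * j) * p M ^+ j.+1 + 'X^M * r)
  /\ (exists r, denom a b j.+2 * p M
    = denom a b j.+1 + (b ^+ j.+1)%:P * 'X^(3 * j.+1) * p M ^+ j.+2 + 'X^M * r) by [].
elim: j => [|j [[r1 E1] [r2 E2]]].
  split; first by exists 0; rewrite /= muln0 !expr0 polyC1; ring.
  exists r0; rewrite muln1 !expr1 /denom mulr1 mulr0 subr0 mulrBl mul1r {1}r0E; ring.
split; first by exists r2.
pose B := (b ^+ j.+1)%:P * 'X^(3 * j.+1) * p M ^+ j.+1.
exists ((1 - a%:P * 'X) * r2 - b%:P * 'X^3 * r1 + B * r0).
have -> : 'X^M * ((1 - a%:P * 'X) * r2 - b%:P * 'X^3 * r1 + B * r0)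
    = 'X^M * ((1 - a%:P * 'X) * r2 - b%:P * 'X^3 * r1)
      + B * (p M - 1 - a%:P * 'X * p M - b%:P * 'X^3 * p M ^+ 2).
  by rewrite {1}r0E; ring.
rewrite (denomSS a b j.+1) mulrBl -(mulrA (1 - a%:P * 'X)) E2.
rewrite -(mulrA (b%:P * 'X^3)) E1 [in RHS]denomSS /B.
have XS k : 'X^(3 * k.+1) = 'X^3 * 'X^(3 * k) :> {poly K}.
  by rewrite mulnS exprD.
by rewrite !XS !(exprS b) !(exprS (p M)) !polyCM; ring.
Qed.

Lemma coef_denom_mul M j i : (i < M)%N -> (denom a b j.+1 * p M)`_i
  = (denom a b j)`_i
    + b ^+ j * (if (i < 3 * j)%N then 0 else (p M ^+ j.+1)`_(i - 3 * j)).
Proof.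
move=> iM; have [r ->] := denom_mul_truncation M j.
by rewrite !coefD -mulrA coefCM !coefXnM iM addr0.
Qed.

Lemma coef0_truncation_exp M k : (0 < M)%N -> (p M ^+ k)`_0 = 1.
Proof.
move=> M0; rewrite -horner_coef0 horner_exp horner_coef0 coef_poly M0.
by rewrite hc /fps_add /fps_scale !fps_mulXE !mulr0 !addr0 expr1n.
Qed.

(** Column [i] reads off degree [3n+i], above the degree of [denom n.*2]; the error term starts in
    degree [6n], that is, in the last column. *)
Lemma rev_denom_hankel n :
  rev_coefs (3 * n) (denom a b n.*2.+1) *m hankel c (3 * n).+1
    = b ^+ n.*2 *: delta_mx 0 ord_max.
Proof.
rewrite (@rev_coefs_hankel _ _ (3 * n).*2.+1) //; last first.
  exact: (size_denom a b n).1.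
apply/rowP=> i; have lt_i := ltn_ord i; rewrite !mxE eqxx /=.
rewrite coef_denom_mul; last by lia.
rewrite coef_denom_even ?add0r; last by lia.
congr (_ * _); rewrite -val_eqE /=; case: ltnP => le_i.
  by rewrite (_ : _ == _ = false) //; lia.
rewrite (_ : (3 * n + i - 3 * n.*2 = 0)%N); last by lia.
by rewrite coef0_truncation_exp // (_ : _ == _) //; lia.
Qed.

(** The error term starts in degree [6n+3]; the factor ['X] moves it to [6n+4], the last column in
    size [3n+3]. *)
Lemma rev_X_denom_hankel n :
  rev_coefs (3 * n).+2 ('X * denom a b n.*2.+2) *m hankel c (3 * n).+3
    = b ^+ n.*2.+1 *: delta_mx 0 ord_max.
Proof.
have szW : (size ('X * denom a b n.*2.+2)%R <= (3 * n).+3)%N.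
  apply/leq_sizeP => -[|i] // le_i.
  by rewrite coefXM /= -doubleS coef_denom_even //; lia.
rewrite (@rev_coefs_hankel _ _ (3 * n).+2.*2.+1) //.
apply/rowP=> i; have lt_i := ltn_ord i; rewrite !mxE eqxx /=.
rewrite -mulrA coefXM /= coef_denom_mul; last by lia.
rewrite coef_denom_odd ?add0r; last by lia.
congr (_ * _); rewrite -val_eqE /=; case: ltnP => le_i.
  by rewrite (_ : _ == _ = false) //; lia.
rewrite (_ : (3 * n + i).+1 - _ = 0)%N; last by lia.
by rewrite coef0_truncation_exp // (_ : _ == _) //; lia.
Qed.

(** The recursion jumps over size [3n+2], where the determinant vanishes. *)
Lemma det_hankel n :
  \det (hankel c (3 * n).+1) = (-1) ^+ n * b ^+ (3 * n ^ 2 + n) /\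
  \det (hankel c (3 * n).+3) = (-1) ^+ n.+1 * b ^+ (3 * n ^ 2 + 5 * n + 2).
Proof.
have step m : \det (hankel c (3 * m).+3)
    = - (b ^+ m.*2.+1) ^+ 2 * \det (hankel c (3 * m).+1).
  exact: det_hankel_rec2 (coef0_denom _ _ _) (rev_X_denom_hankel m).
have step' m := det_hankel_rec (coef0_denom _ _ _) (rev_denom_hankel m).
suff det1 : \det (hankel c (3 * n).+1) = (-1) ^+ n * b ^+ (3 * n ^ 2 + n).
  split=> //; rewrite step det1 -exprM mulNr mulrCA -exprD exprS mulN1r mulNr.
  by congr (- (_ * b ^+ _)); lia.
elim: n => [|n IH]; first by rewrite step' det_mx00 !expr0.
rewrite step' (_ : 3 * n.+1 = (3 * n).+3)%N; last by lia.
rewrite step IH -exprM mulNr mulrN mulrCA mulrA -exprD mulrCA -exprD exprS mulN1r mulNr.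
by congr (- (_ * b ^+ _)); lia.
Qed.

Lemma shifted_hankel_det_3n1 n : shifted_hankel_det 2 c (3 * n + 1)
  = (-1) ^+ n * n.+1%:R ^+ 2 * a ^+ 2 * b ^+ (3 * n ^ 2 + 3 * n).
Proof.
rewrite addn1 (@shifted_hankel_det_singular _ c _ (denom a b n.*2.+2)).
- have [_ -> _ _] := denom_coefs a b n.
  have sqr_b : ((- b) ^+ n) ^+ 2 = b ^+ (2 * n).
    by rewrite -exprM mulnC exprM sqrrN -exprM.
  rewrite (det_hankel n).1 exprMn sqr_b.
  rewrite (_ : 3 * n ^ 2 + 3 * n = 2 * n + (3 * n ^ 2 + n))%N; last by lia.
  by rewrite (exprD b (2 * n)); ring.
- exact: coef0_denom.
rewrite (@rev_coefs_hankel _ _ (3 * n).+1.*2.+1) //; last first.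
  exact: (size_denom a b n).2.
apply/rowP=> i; have lt_i := ltn_ord i; rewrite !mxE.
rewrite coef_denom_mul; last by lia.
rewrite coef_denom_odd ?ifT ?mulr0 ?addr0 //; lia.
Qed.

(* The next two combinations are, up to scaling, the reversals of the
   Christoffel-Darboux kernels at 0 of the orthogonal polynomials. *)
Lemma shifted_hankel_det_3n_scaled n :
  ((denom a b n.*2.+2)`_(3 * n) + n.+1%:R * a * ('X * denom a b n.*2.+1)`_(3 * n))
    * \det (hankel c (3 * n).+1)
  = (- b) ^+ n * shifted_hankel_det 2 c (3 * n).
Proof.
(* The factor [(n+1)a] cancels degree [3n+1]. In the product with the series, only the top
   coefficient of [denom n.*2.+1] survives, in column 0. *)
pose W := denom a b n.*2.+2 + (n.+1%:R * a)%:P * ('X * denom a b n.*2.+1).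
have [top_e top_o _ _] := denom_coefs a b n.
have szW : (size W <= (3 * n).+1)%N.
  apply/leq_sizeP => -[|i] // le_i; rewrite coefD coefCM coefXM /=.
  have [<-|lt_i] := eqVneq (3 * n)%N i; first by rewrite top_e top_o; ring.
  rewrite -doubleS coef_denom_even ?coef_denom_odd ?mulr0 ?addr0 //; lia.
have -> : (denom a b n.*2.+2)`_(3 * n)
    + n.+1%:R * a * ('X * denom a b n.*2.+1)`_(3 * n) = W`_(3 * n).
  by rewrite [RHS]coefD coefCM.
apply: shifted_hankel_det_scaled.
rewrite (@rev_coefs_hankel _ _ (3 * n).*2.+1) //.
apply/rowP=> i; have lt_i := ltn_ord i; rewrite !mxE eqxx /=.
rewrite mulrDl coefD -!mulrA coefCM.
rewrite [('X * _)`_ _](_ : _ = 0) ?mulr0 ?addr0; last first.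
  rewrite coefXM; case: eqVneq => // pos; rewrite coef_denom_mul; last by lia.
  by rewrite coef_denom_even ?ifT ?mulr0 ?addr0 //; lia.
rewrite coef_denom_mul; last by lia.
rewrite ifT ?mulr0 ?addr0; last by lia.
rewrite -val_eqE /=; case: eqVneq => [->|i0].
  by rewrite addn0 top_e mulr1.
by rewrite mulr0 coef_denom_odd //; lia.
Qed.

Lemma shifted_hankel_det_3n2_scaled n :
  (n.+1%:R * a * (denom a b n.*2.+3)`_(3 * n).+2 - b * (denom a b n.*2.+2)`_(3 * n))
    * \det (hankel c (3 * n).+3)
  = (- b) ^+ n.+1 * shifted_hankel_det 2 c (3 * n).+2.
Proof.
(* The weights cancel degree [3n+3]. *)
pose W := (n.+1%:R * a)%:P * denom a b n.*2.+3
          - b%:P * ('X * ('X * denom a b n.*2.+2)).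
have [top_e top_o _ _] := denom_coefs a b n.
have [top_e' _ _ _] := denom_coefs a b n.+1.
have szW : (size W <= (3 * n).+3)%N.
  apply/leq_sizeP => -[|[|i]] // le_i; rewrite coefB !coefCM !coefXM /=.
  rewrite -[n.*2.+2]doubleS; have [i_eq|lt_i] := eqVneq i (3 * n).+1.
    rewrite i_eq (_ : (3 * n).+3 = 3 * n.+1)%N; last by lia.
    by rewrite top_e' doubleS top_o exprS; ring.
  by rewrite coef_denom_odd ?coef_denom_even ?mulr0 ?subr0 //; lia.
have -> : n.+1%:R * a * (denom a b n.*2.+3)`_(3 * n).+2
    - b * (denom a b n.*2.+2)`_(3 * n) = W`_(3 * n).+2.
  by rewrite [RHS]coefB !coefCM !coefXM.
apply: shifted_hankel_det_scaled.
rewrite (@rev_coefs_hankel _ _ (3 * n).+2.*2.+1) //.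
apply/rowP=> i; have lt_i := ltn_ord i; rewrite !mxE eqxx /=.
rewrite mulrBl coefB -!mulrA !coefCM !coefXM /= !coef_denom_mul; try lia.
rewrite !ifT; try lia.
rewrite !mulr0 !addr0 -[n.*2.+2]doubleS coef_denom_even; last by lia.
rewrite mulr0 sub0r -val_eqE /=; case: eqVneq => [->|i0].
  by rewrite addn0 top_e mulr1 exprS mulNr.
by rewrite mulr0 coef_denom_odd ?mulr0 ?oppr0 //; lia.
Qed.

End Expansion.

(** Links the sum of squares to the binomials in the top coefficients; the additive form avoids
    truncated subtraction. *)
Lemma sum_squares_binomial n :
  (\sum_(0 <= i < n.+1) i ^ 2 + 'C(n.+2, 3) = n.+1 * 'C(n.+1, 2))%N.
Proof.
elim: n => [|n IH]; first by rewrite big_nat1.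
rewrite big_nat_recr //= (binS n.+2) (binS n.+1 1) bin1.
move: IH; nia.
Qed.

(** * Cancelling the powers of [-b] *)

Section ShiftedDeterminants.
Variables (K : idomainType) (a b : K) (c : fps K).
Hypothesis hc : f3_equation a b c.

(** For [b = 0] the sequence is geometric, so the second row is [a] times the first. *)
Lemma shifted_hankel_det_b0 N : b = 0 -> shifted_hankel_det 2 c N.+2 = 0.
Proof.
move=> b0; rewrite /shifted_hankel_det; set A := \matrix_(_, _) _.
have cS m : c m.+1 = a * c m.
  by rewrite hc /fps_add /fps_scale !fps_mulXE b0 mul0r addr0 add0r subn1.
pose i1 : 'I_N.+2 := lift 0 0.
pose v : 'rV[K]_N.+2 := delta_mx 0 i1 - a *: delta_mx 0 0.
have vA : v *m A = 0 *: delta_mx 0 0.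
  rewrite scale0r mulmxBl -scalemxAl -!rowE; apply/rowP=> j.
  by rewrite !mxE cS subrr.
have := cofactor_of_row_combination i1 vA.
by rewrite !mxE /= mulr0 subr0 mul1r mul0r.
Qed.

Lemma shifted_hankel_det_3n n : shifted_hankel_det 2 c (3 * n.+1)
  = (-1) ^+ n.+2 * b ^+ (3 * n.+1 ^ 2 + n.+1 - 1)
    * (a ^+ 3 * (\sum_(0 <= i < n.+2) i ^ 2)%:R - n.+2%:R * b).
Proof.
have [b0|b_neq0] := eqVneq b 0.
  rewrite mulnS shifted_hankel_det_b0 // b0.
  by rewrite (_ : 3 * _ + _ - 1 = (3 * n.+1 ^ 2 + n - 1).+1)%N ?exprS; [ring | lia].
have nb_neq0 : - b != 0 by rewrite oppr_eq0.
have := shifted_hankel_det_3n_scaled hc n.+1.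
have [_ _ _ E4] := denom_coefs a b n.+1.
have [_ _ E3 _] := denom_coefs a b n.
rewrite (det_hankel hc n.+1).1 coefXM (_ : (3 * n.+1).-1 = (3 * n).+2); last by lia.
rewrite muln_eq0 /= doubleS E3.
have /(congr1 (fun m => m%:R : K)) := sum_squares_binomial n.+1.
rewrite natrD natrM => sumE scaled.
(* One factor [-b] more than in [scaled], as required by the form of [E4]. *)
apply/(mulfI (expf_neq0 n.+2 nb_neq0)).
rewrite doubleS in E4; rewrite exprS -mulrA -scaled [LHS]mulrA [- b * _]mulrDr E4.
have -> : (\sum_(0 <= i < n.+2) i ^ 2)%:R
    = n.+2%:R * 'C(n.+2, 2)%:R - 'C(n.+3, 3)%:R :> K by rewrite -sumE; ring.
have -> : b ^+ (3 * n.+1 ^ 2 + n.+1) = b * b ^+ (3 * n.+1 ^ 2 + n.+1 - 1).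
  by rewrite -exprS; congr (_ ^+ _); lia.
move: (b ^+ (_ - 1)) => x; rewrite !exprS; ring.
Qed.

Lemma shifted_hankel_det_3n2 n : shifted_hankel_det 2 c (3 * n + 2)
  = (-1) ^+ n * b ^+ (3 * n ^ 2 + 5 * n + 1)
    * (a ^+ 3 * (\sum_(0 <= i < n.+2) i ^ 2)%:R - n.+1%:R * b).
Proof.
rewrite addn2; have [b0|b_neq0] := eqVneq b 0.
  by rewrite shifted_hankel_det_b0 // b0 addn1 exprS; ring.
have nb_neq0 : - b != 0 by rewrite oppr_eq0.
have := shifted_hankel_det_3n2_scaled hc n.
have [_ _ E3 E4] := denom_coefs a b n.
rewrite (det_hankel hc n).2 -mulNr E3 E4.
have /(congr1 (fun m => m%:R : K)) := sum_squares_binomial n.+1.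
rewrite (binS n.+2) natrD (natrD _ 'C(n.+2, 3)) natrM => sumE scaled.
apply/(mulfI (expf_neq0 n.+1 nb_neq0)); rewrite -scaled.
have -> : (\sum_(0 <= i < n.+2) i ^ 2)%:R
    = n.+2%:R * 'C(n.+2, 2)%:R - ('C(n.+2, 3)%:R + 'C(n.+2, 2)%:R) :> K.
  by rewrite -sumE; ring.
have -> : b ^+ (3 * n ^ 2 + 5 * n + 2) = b * b ^+ (3 * n ^ 2 + 5 * n + 1).
  by rewrite -exprS; congr (_ ^+ _); lia.
move: (b ^+ (_ + 1)) => x; rewrite !exprS; ring.
Qed.

End ShiftedDeterminants.

(** At [n = 0] the first exponent would be -1, which natural subtraction truncates to 0; the empty
    determinant is therefore given separately. *)
Theorem theorem6p4 (R : realType) (a b : R[i]) (c : fps R[i])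
    (hc : f3_equation a b c) (n : nat) :
  [/\ shifted_hankel_det 2 c (3 * n)
        = (if n == 0%N then 1 else
           (-1) ^+ n.+1 * b ^+ (3 * n ^ 2 + n - 1)
             * (a ^+ 3 * (\sum_(0 <= i < n.+1) i ^ 2)%:R - n.+1%:R * b)),
      shifted_hankel_det 2 c (3 * n + 1)
        = (-1) ^+ n * n.+1%:R ^+ 2 * a ^+ 2 * b ^+ (3 * n ^ 2 + 3 * n)
    & shifted_hankel_det 2 c (3 * n + 2)
        = (-1) ^+ n * b ^+ (3 * n ^ 2 + 5 * n + 1)
            * (a ^+ 3 * (\sum_(0 <= i < n.+2) i ^ 2)%:R - n.+1%:R * b)].
Proof.
split.
- by case: n => [|n]; [exact: det_mx00 | exact: shifted_hankel_det_3n].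
- exact: shifted_hankel_det_3n1.
- exact: shifted_hankel_det_3n2.
Qed.
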